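(* Let $A$ be a real generic commutative algebra with $\dim_{\mathbb{R}}A=2$, and let $c_1,c_2,c_3$ be its three distinct nonzero idempotents. For $1\le i\le 3$ let $1,\lambda_i$ be the eigenvalues (counted with multiplicity) of $L_{c_i}$; then $\lambda_i\in\mathbb{R}$ and $\lambda_i\neq\frac12$. Put $$a_i=\frac{1}{1-2\lambda_i},\qquad i=1,2,3.$$ Then there are only three possible unordered sign configurations of $(a_1,a_2,a_3)$, namely $$\{+,+,+\},\qquad \{+,+,-\},\qquad \{+,-,-\}$$ (the configuration $\{-,-,-\}$ is impossible). Moreover, each of these three configurations is realized by some two-dimensional real generic commutative algebra.
   Context: An algebra means a finite-dimensional commutative, not necessarily associative, algebra. For $y\in A$, $L_y:A\to A$ denotes the multiplication operator $L_yx=yx$. An idempotent is an element $c$ with $c^2=c$ (zero included). For an algebra $A$ over $\mathbb{R}$, $A_{\mathbb{C}}=A\otimes_{\mathbb{R}}\mathbb{C}$ is its complexification. $A$ is called generic if $A_{\mathbb{C}}$ contains exactly $2^n$ distinct idempotents (including $0$), where $n=\dim A$. $A$ is called a real generic algebra if it is an algebra over $\mathbb{R}$ which is generic and all idempotents of $A_{\mathbb{C}}$ lie in $A$; thus a two-dimensional real generic algebra has exactly four idempotents $0,c_1,c_2,c_3$. *)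

(* Defs.v *)
From HB Require Import structures.
From mathcomp Require Import all_boot all_order all_algebra.
From mathcomp Require Import complex.
From mathcomp Require Import reals.

Set Implicit Arguments.
Unset Strict Implicit.
Unset Printing Implicit Defensive.
Import Order.TTheory GRing.Theory Num.Theory.
Local Open Scope ring_scope.
Local Open Scope complex_scope.

(* Finite-dimensional commutative algebras, with neither associativity nor a
   unit.  Linearity in the second argument follows from commutativity. *)
HB.mixin Record Vector_isCommNAAlgebra (K : fieldType) A of Vector K A := {
  amul : A -> A -> A;
  amulC : commutative amul;
  amulDl : left_distributive amul +%R;
  amulZl : forall (k : K) (x y : A), amul (k *: x) y = k *: amul x y
}.

#[short(type="commAlgebraType")]
HB.structure Definition CommNAAlgebra (K : fieldType) :=
  { A of Vector_isCommNAAlgebra K A & Vector K A }.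

Section Multiplication.
Variables (K : fieldType) (A : commAlgebraType K).
Implicit Types x y : A.

Lemma amul_is_linear y : linear (amul y : A -> A).
Proof. by move=> k u v; rewrite !(amulC y) amulDl amulZl. Qed.

HB.instance Definition _ y :=
  GRing.isLinear.Build K A A *:%R (amul y) (amul_is_linear y).

Definition mulop y : 'End(A) := linfun (amul y).

Lemma mulopE y x : mulop y x = amul y x.
Proof. by rewrite lfunE. Qed.

Definition idempotent x := amul x x == x.

End Multiplication.

(* The complexification: the pair (x, y) stands for the element
   x (x) 1 + y (x) 'i of the tensor product of A with R[i]. *)
Definition complexification (R : rcfType) (A : Type) : Type := (A * A)%type.

Section ComplexificationVector.
Variables (R : rcfType) (A : vectType R).
Local Notation A_C := (complexification R A).

HB.instance Definition _ := GRing.Zmodule.copy A_C (A * A)%type.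

Definition cscale (z : R[i]) (u : A_C) : A_C :=
  (complex.Re z *: u.1 - complex.Im z *: u.2,
   complex.Re z *: u.2 + complex.Im z *: u.1).

Fact cscaleA a b u : cscale a (cscale b u) = cscale (a * b) u.
Proof.
case: a b u => [a a'] [b b'] [x y]; rewrite /cscale /=.
rewrite !scalerDr !scalerDl !scalerN !scalerA !scaleNr !opprD.
by congr (_, _); rewrite (AC (2*2) ((1*4)*(2*3))).
Qed.

Fact cscale1 : left_id 1 cscale.
Proof. by case=> x y; rewrite /cscale /= !scale1r !scale0r subr0 addr0. Qed.

Fact cscaleDr : right_distributive cscale +%R.
Proof.
move=> z [x y] [x' y']; rewrite /cscale /=.
by congr (_, _); rewrite /= !scalerDr ?opprD addrACA.
Qed.

Fact cscaleDl u : {morph cscale^~ u : a b / a + b}.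
Proof.
case: u => x y [a a'] [b b']; rewrite /cscale /=.
by congr (_, _); rewrite /= !scalerDl ?opprD addrACA.
Qed.

HB.instance Definition _ :=
  GRing.Zmodule_isLmodule.Build R[i] A_C cscaleA cscale1 cscaleDr cscaleDl.

Import VectorInternalTheory.

Fact complexification_vect_iso : Vector.axiom (dim A) A_C.
Proof.
pose f (u : A_C) : 'rV[R[i]]_(dim A) :=
  \row_j (v2r u.1 0 j +i* v2r u.2 0 j)%C.
pose g (w : 'rV[R[i]]_(dim A)) : A_C :=
  (r2v (map_mx (@complex.Re R) w), r2v (map_mx (@complex.Im R) w)).
exists f.
  move=> [a a'] [x y] [x' y']; apply/rowP=> j; rewrite !mxE /=.
  rewrite !linearD /= !linearN !linearZ /= !mxE.
  by rewrite mulrN; apply/eqP; rewrite eq_complex /= !eqxx.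
exists g.
  move=> [x y]; rewrite /g; congr (_, _); apply: (canLR v2rK);
  by apply/rowP=> j; rewrite !mxE.
move=> w; apply/rowP=> j; rewrite !mxE /= !r2vK !mxE.
by case: (w 0 j).
Qed.

HB.instance Definition _ :=
  Lmodule_hasFinDim.Build R[i] A_C complexification_vect_iso.

End ComplexificationVector.

Section ComplexificationAlgebra.
Variables (R : rcfType) (A : commAlgebraType R).
Local Notation A_C := (complexification R A).

Definition cmul (u v : A_C) : A_C :=
  (amul u.1 v.1 - amul u.2 v.2, amul u.1 v.2 + amul u.2 v.1).

Fact cmulC : commutative cmul.
Proof.
move=> [x y] [x' y']; rewrite /cmul /=.
rewrite (amulC x x') (amulC y y') (amulC x y') (amulC y x').
by congr (_, _); rewrite addrC.
Qed.

Fact cmulDl : left_distributive cmul +%R.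
Proof.
move=> [x y] [x' y'] [u v]; rewrite /cmul /=.
by congr (_, _); rewrite /= !amulDl ?opprD addrACA.
Qed.

Fact cmulZl (k : R[i]) (u v : A_C) : cmul (k *: u) v = k *: cmul u v.
Proof.
case: k u v => [a b] [x y] [x' y'].
rewrite /GRing.scale /= /cmul /cscale /= -!scaleNr !amulDl !amulZl !scalerDr.
rewrite !scalerN !scaleNr opprD.
by congr (_, _); rewrite (AC (2*2) ((1*3)*(4*2))).
Qed.

HB.instance Definition _ :=
  Vector_isCommNAAlgebra.Build R[i] A_C cmulC cmulDl cmulZl.

Definition complexify (x : A) : A_C := (x, 0).

Lemma complexificationE (u : A_C) :
  u = complexify u.1 + 'i *: complexify u.2.
Proof.
case: u => x y; rewrite /GRing.scale /= /cscale /complexify /=.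
by congr (_, _); rewrite /= ?scale0r ?scale1r ?subr0 ?addr0 ?add0r.
Qed.

Lemma complexifyM (x y : A) :
  amul (complexify x) (complexify y) = complexify (amul x y).
Proof.
rewrite -[LHS]/(cmul _ _) /cmul /complexify /=.
by rewrite (amulC 0 y) !linear0 !addr0.
Qed.

Lemma dim_complexification : \dim {:A_C} = \dim {:A}.
Proof. by rewrite !dimvf. Qed.

Definition generic :=
  exists2 s : (2 ^ \dim {:A}).-tuple A_C,
    uniq s & forall u : A_C, (u \in s) = idempotent u.

Definition real_generic :=
  generic /\ forall u : A_C, idempotent u -> exists x : A, u = complexify x.

(* c enumerates the nonzero idempotents of A without repetition. *)
Definition nonzero_idempotents (n : nat) (c : 'I_n -> A) :=
  injective c /\
  forall x : A, (idempotent x && (x != 0)) <-> (exists i, x = c i).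

End ComplexificationAlgebra.

Definition endo_char_poly (K : fieldType) (V : vectType K) (f : 'End(V)) :=
  char_poly (passmx.mxof (vbasis {:V}) (vbasis {:V}) f).

(* s lists the complex eigenvalues of the real operator f, with algebraic
   multiplicities. *)
Definition eigenvalues (R : rcfType) (V : vectType R) (f : 'End(V))
    (s : seq R[i]) :=
  map_poly (real_complex R) (endo_char_poly f) = \prod_(z <- s) ('X - z%:P).

(* Unordered configurations: s and signs agree up to a permutation. *)
Definition sign_configuration (R : realDomainType) (n : nat) (a : 'I_n -> R)
    (signs : seq R) :=
  perm_eq [seq Num.sg (a i) | i : 'I_n] signs.

(* Main.v *)
From HB Require Import structures.
Require Import Defs.
From mathcomp Require Import all_boot all_order all_algebra.
From mathcomp Require Import complex.
From mathcomp Require Import reals.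
From mathcomp Require Import ring lra.
Set Implicit Arguments.
Unset Strict Implicit.
Unset Printing Implicit Defensive.
Import Order.TTheory GRing.Theory Num.Theory.
Local Open Scope ring_scope.
Local Open Scope complex_scope.

(** The nonzero idempotents e, f, g of a real generic plane algebra are pairwise
    independent, so that g = x e + y f with x and y nonzero.  Writing
    e f = p e + q f, the eigenvalues of the multiplications by e, f and g
    other than 1 are q, p and x + y p - x q, while g being idempotent means
    x + 2 p y = 1 and y + 2 q x = 1.  Eliminating p and q gives
<<
      a_1 = x / (x + y - 1),  a_2 = y / (x + y - 1),  a_3 = -1 / (x + y - 1).
>>
    These are the barycentric coordinates of the idempotent 0 with respect to
    the triangle e f g.  In particular they sum to 1, hence are not all
    negative, and this is the only obstruction.  The triangle is not flat: if
    x + y = 1 then p = q = 1/2 and the whole line through e and f consists of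
    idempotents, which contradicts there being three of them
    ([nonzero_idempotents_noncollinear], [inverse_eigenvalues_sum1]).

    The configurations are realized by the algebras with basis of idempotents
    e, f and product e f = k (e + f), for k = -1, 0 and 1.  The third nonzero
    idempotent is (e + f) / (1 + 2 k), over the complex numbers as well as over
    the reals, because the determination of the idempotents
    ([sym_idempotents_all]) is valid over every field and the product of the
    complexification has the same form.  The eigenvalues other than 1 are
    k, k and 1 / (1 + 2 k). *)

Local Notation idempotent := Defs.idempotent.

(** * Characteristic polynomials in an arbitrary basis *)

Lemma char_poly_similar (K : fieldType) (n : nat) (P M N : 'M[K]_n) :
  P \in unitmx -> P *m M = N *m P -> char_poly M = char_poly N.
Proof.
move=> Pu PM.
have PMX : map_mx polyC P *m char_poly_mx M = char_poly_mx N *m map_mx polyC P.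
  rewrite /char_poly_mx mulmxBr mulmxBl -!map_mxM PM.
  by rewrite mul_mx_scalar mul_scalar_mx.
apply: (@mulfI _ (\det P)%:P).
  by rewrite polyC_eq0 -unitfE -unitmxE.
by rewrite -det_map_mx -det_mulmx PMX det_mulmx mulrC.
Qed.

(** The characteristic polynomial of an endomorphism is defined by means of a
    fixed basis of the space; this gives access to it through the basis at
    hand. *)
Lemma endo_char_polyE (K : fieldType) (V : vectType K) (n : nat)
    (b : n.-tuple V) (f : 'End(V)) (M : 'M[K]_n) :
  basis_of fullv b -> (forall i : 'I_n, f b`_i = \sum_j M i j *: b`_j) ->
  endo_char_poly f = char_poly M.
Proof.
move=> bB fb; have Dn := size_basis bB.
case: n / Dn b M bB fb => b M bB fb.
have vB := vbasisP {:V}.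
pose P := passmx.mxof b (vbasis fullv) \1%VF.
pose Q := passmx.mxof (vbasis fullv) b \1%VF.
have PQ : P *m Q = 1%:M.
  by rewrite -passmx.mxof_comp // comp_lfun1l passmx.mxof1 // (basis_free bB).
have {fb}-> : M = passmx.mxof b b f.
  apply/row_matrixP=> i; rewrite [RHS]rowE passmx.mul_mxof.
  rewrite passmx.vecof_delta fb.
  rewrite -[LHS](passmx.vecofK bB) /passmx.vecof; congr passmx.rVof.
  by apply: eq_bigr => j _; rewrite mxE.
apply: (@char_poly_similar _ _ P); first by case/mulmx1_unit: PQ.
by rewrite -!passmx.mxof_comp // comp_lfun1l comp_lfun1r.
Qed.

Lemma eigenvaluesE (R : rcfType) (V : vectType R) (f : 'End(V)) (l : R) :
  endo_char_poly f = ('X - 1%:P) * ('X - l%:P) ->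
  forall z : R[i], eigenvalues f [:: 1; z] <-> z = l%:C.
Proof.
move=> fE z; rewrite /eigenvalues fE rmorphM /= !map_polyXsubC /= rmorph1.
rewrite !big_cons big_nil mulr1; split=> [|-> //].
by move/(mulfI (negbT (polyXsubC_eq0 _)))/(addrI _)/oppr_inj/polyC_inj ->.
Qed.

(** * Two independent idempotents *)

Section TwoIdempotents.
Variables (K : fieldType) (A : commAlgebraType K).
Implicit Types (e f v : A).

Lemma amulDr : right_distributive (@amul K A) +%R.
Proof. by move=> e u v; rewrite linearD. Qed.

Lemma amulZr (k : K) e f : amul e (k *: f) = k *: amul e f.
Proof. by rewrite linearZ. Qed.

(** If e = k f, then k f = e = e e = k^2 f, so that k is 0 or 1. *)
Lemma idempotents_free e f :
  idempotent e -> idempotent f -> e != 0 -> f != 0 -> e != f ->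
  free [:: e; f].
Proof.
move=> /eqP ee /eqP ff e0 f0 ef; rewrite free_cons seq1_free f0 andbT span_seq1.
apply/negP=> /vlineP[k ek]; have := ee; rewrite ek amulZl amulZr ff scalerA.
move/eqP; rewrite -subr_eq0 -scalerBl scaler_eq0 (negPf f0) orbF.
rewrite -{3}[k]mulr1 -mulrBr mulf_eq0 subr_eq0.
case/orP=> /eqP kE; move: ek; rewrite kE ?scale0r ?scale1r => eE.
  by rewrite eE eqxx in e0.
by rewrite eE eqxx in ef.
Qed.

Lemma free2P e f :
  reflect (forall a b : K, a *: e + b *: f = 0 -> a = 0 /\ b = 0)
          (free [:: e; f]).
Proof.
rewrite free_cons seq1_free span_seq1.
apply: (iffP andP) => [[eNf f0] a b ab|ef].
  have a0 : a = 0.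
    apply/eqP; apply: contraNT eNf => a0; apply/vlineP; exists (- (b / a)).
    apply: (scalerI a0); rewrite scalerA mulrN mulrC divfK // scaleNr.
    by apply/eqP; rewrite -addr_eq0 ab.
  move: ab; rewrite a0 scale0r add0r => /eqP.
  by rewrite scaler_eq0 (negPf f0) orbF => /eqP.
split; last first.
  apply/eqP=> f0; have [|_ /eqP] := ef 0 1.
    by rewrite f0 scale0r scaler0 addr0.
  by rewrite oner_eq0.
apply/vlineP=> -[k ek]; have [|/eqP] := ef 1 (- k).
  by rewrite scale1r scaleNr ek subrr.
by rewrite oner_eq0.
Qed.

Lemma free2_inj e f (a b a' b' : K) : free [:: e; f] ->
  (a *: e + b *: f == a' *: e + b' *: f) = (a == a') && (b == b').
Proof.
move=> /free2P ef; apply/eqP/andP => [E|[/eqP-> /eqP->]//].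
have [|/eqP + /eqP] := ef (a - a') (b - b'); last by rewrite !subr_eq0.
by rewrite !scalerBl addrACA -opprD E subrr.
Qed.

Lemma lin2D e f (a b a' b' : K) :
  a *: e + b *: f + (a' *: e + b' *: f) = (a + a') *: e + (b + b') *: f.
Proof. by rewrite !scalerDl addrACA. Qed.

Lemma lin2Z e f (k a b : K) :
  k *: (a *: e + b *: f) = (k * a) *: e + (k * b) *: f.
Proof. by rewrite scalerDr !scalerA. Qed.

Hypothesis dimA : \dim {:A} = 2%N.

Lemma free2_basis e f : free [:: e; f] -> basis_of fullv [:: e; f].
Proof. by move=> ef; rewrite basisEfree ef subvf dimA. Qed.

Lemma free2_coord e f v : free [:: e; f] -> exists a b, v = a *: e + b *: f.
Proof.
move=> /free2_basis/span_basis ef.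
have: v \in <<[:: e; f]>>%VS by rewrite ef memvf.
rewrite span_cons span_seq1 => /memv_addP[_ /vlineP[a ->] [_ /vlineP[b ->] ->]].
by exists a, b.
Qed.

Section Product.
Variables (e f : A) (p q : K).
Hypotheses (ef_free : free [:: e; f]) (ee : idempotent e) (ff : idempotent f).
Hypothesis ef : amul e f = p *: e + q *: f.

(** In the basis e, f the multiplication by e has the triangular matrix with
    rows (1, 0) and (p, q). *)
Lemma mulop_char_poly :
  endo_char_poly (mulop e) = ('X - 1%:P) * ('X - q%:P).
Proof.
pose M : 'M[K]_2 := \matrix_(i, j)
  if i == 0 then (j == 0)%:R else if j == 0 then p else q.
rewrite (@endo_char_polyE _ _ _ [tuple e; f] _ M) /=; last 2 first.
- exact: free2_basis.
- case=> [[|[|//]] i2]; rewrite mulopE !big_ord_recl big_ord0 !mxE /= addr0.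
    by rewrite (eqP ee) scale1r scale0r addr0.
  by rewrite ef.
rewrite /char_poly (expand_det_row _ 0) !big_ord_recl big_ord0 /cofactor.
rewrite !det_mx11 !mxE /=.
by rewrite !mulr1n !mulr0n /= subr0 mul0r !addr0 expr0 mul1r.
Qed.

Lemma amul_coord (x y : K) :
  amul e (x *: e + y *: f) = (x + y * p) *: e + (y * q) *: f.
Proof. by rewrite amulDr !amulZr (eqP ee) ef lin2Z scalerDl addrA. Qed.

Lemma idempotent_coord (x y : K) :
  idempotent (x *: e + y *: f) =
  (x * (x + 2 * p * y) == x) && (y * (y + 2 * q * x) == y).
Proof.
rewrite -(@free2_inj e f) // /idempotent; congr (_ == _).
have fM : amul f (x *: e + y *: f) = (x * p) *: e + (x * q + y) *: f.
  by rewrite amulDr !amulZr (eqP ff) amulC ef lin2Z scalerDl addrA.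
rewrite amulDl !amulZl amul_coord fM !lin2Z lin2D.
by congr (_ *: _ + _ *: _); ring.
Qed.

End Product.

(** For g = x e + y f, the basis g, e puts the multiplication by g in
    triangular form: g e = q g + (x + y p - x q) e. *)
Lemma mulop_char_poly_comb e f (p q x y : K) :
  free [:: e; f] -> idempotent e -> idempotent (x *: e + y *: f) ->
  y != 0 -> amul e f = p *: e + q *: f ->
  endo_char_poly (mulop (x *: e + y *: f)) =
    ('X - 1%:P) * ('X - (x + y * p - x * q)%:P).
Proof.
set g := x *: e + y *: f => ef_free ee gg y0 ef.
have g_free : free [:: g; e].
  apply/free2P=> a b; rewrite /g lin2Z.
  have -> : b *: e = b *: e + 0 *: f by rewrite scale0r addr0.
  rewrite lin2D => /(free2P _ _ ef_free)[ab]; rewrite addr0 => /eqP.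
  rewrite mulf_eq0 (negPf y0) orbF => /eqP a0.
  by move: ab; rewrite a0 mul0r add0r.
apply: (mulop_char_poly g_free gg (p := q)).
have eE (k : K) : k *: e = k *: e + 0 *: f by rewrite scale0r addr0.
rewrite amulC (amul_coord ee ef) [in RHS]eE lin2Z lin2D.
by congr (_ *: _ + _ *: _); ring.
Qed.

End TwoIdempotents.

(** * Indices below three and their signs *)

Lemma I3P (i : 'I_3) : [\/ i = 0, i = 1 | i = 2].
Proof.
case: i => [[|[|[|//]]] ?]; [apply: Or31|apply: Or32|apply: Or33];
  exact/val_inj.
Qed.

Lemma enum_I3 : enum 'I_3 = [:: 0; 1; 2].
Proof. by apply: (inj_map val_inj); rewrite val_enum_ord. Qed.

Lemma sumI3 (V : nmodType) (F : 'I_3 -> V) : \sum_i F i = F 0 + F 1 + F 2.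
Proof. by rewrite -big_enum enum_I3 !big_cons big_nil /= addr0 addrA. Qed.

Lemma sign_configurationE (R : realDomainType) (a : 'I_3 -> R) (s : seq R) :
  sign_configuration a s =
  perm_eq [:: Num.sg (a 0); Num.sg (a 1); Num.sg (a 2)] s.
Proof. by rewrite /sign_configuration /image_mem enum_I3. Qed.

(** A positive sum excludes three negative signs and nothing else. *)
Lemma sign_configurations (R : realDomainType) (a : 'I_3 -> R) :
  (forall i, a i != 0) -> 0 < \sum_i a i ->
  [\/ sign_configuration a [:: 1; 1; 1],
      sign_configuration a [:: 1; 1; -1]
    | sign_configuration a [:: 1; -1; -1]].
Proof.
move=> a_neq0 a_gt0; rewrite !sign_configurationE.
have sg i : Num.sg (a i) = 1 \/ Num.sg (a i) = -1 /\ a i < 0.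
  by case: sgrP (a_neq0 i) => [/eqP|? _|? _]; [|left|right].
have [->|[-> a0]] := sg 0; have [->|[-> a1]] := sg 1;
  have [->|[-> a2]] := sg 2.
(* The eight sign patterns, in lexicographic order; a rotation sorts each. *)
- exact: Or31.
- exact: Or32.
- by apply: Or32; rewrite -(perm_rot 2).
- exact: Or33.
- by apply: Or32; rewrite -(perm_rot 1).
- by apply: Or33; rewrite -(perm_rot 1).
- by apply: Or33; rewrite -(perm_rot 2).
- suff : \sum_i a i < 0 by rewrite ltNge ltW.
  by rewrite sumI3; lra.
Qed.

(** * Algebras with exactly three nonzero idempotents *)

Section ThreeIdempotents.
Variables (R : rcfType) (A : commAlgebraType R) (c : 'I_3 -> A).
Hypotheses (dimA : \dim {:A} = 2%N) (cP : nonzero_idempotents c).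

Lemma nonzero_idempotents_free i j : i != j -> free [:: c i; c j].
Proof.
case: cP => c_inj c_all ij.
have [ci ci0] := andP ((c_all (c i)).2 (ex_intro _ i erefl)).
have [cj cj0] := andP ((c_all (c j)).2 (ex_intro _ j erefl)).
by apply: idempotents_free; rewrite // (inj_eq c_inj).
Qed.

Lemma nonzero_idempotent i : idempotent (c i).
Proof. by have /andP[] := (cP.2 (c i)).2 (ex_intro _ i erefl). Qed.

(** On a line of the form x + y = 1 the two equations that say that an element
    with nonzero coordinates is idempotent force p = q = 1/2; then
    t e + (1 - t) f is idempotent for every t, and a value of t other than 0, 1
    and x gives a fourth nonzero idempotent. *)
Lemma nonzero_idempotents_noncollinear (x y : R) :
  c 2 = x *: c 0 + y *: c 1 -> x != 0 -> y != 0 -> x + y != 1.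
Proof.
move=> gE x0 y0; apply/eqP=> xy1.
have ef : free [:: c 0; c 1] by exact: nonzero_idempotents_free.
have [ee ff] := (nonzero_idempotent 0, nonzero_idempotent 1).
have [p [q pq]] := free2_coord dimA (amul (c 0) (c 1)) ef.
have := nonzero_idempotent 2; rewrite gE (idempotent_coord ef ee ff pq).
case/andP=> /eqP xE /eqP yE.
have {}xE : x + 2 * p * y = 1 by apply: (mulfI x0); rewrite mulr1.
have {}yE : y + 2 * q * x = 1 by apply: (mulfI y0); rewrite mulr1.
have pE : p = 2^-1 by apply: (mulfI y0); lra.
have qE : q = 2^-1 by apply: (mulfI x0); lra.
have [t /and3P[t0 t1 tx]] : exists t : R, [&& t != 0, t != 1 & t != x].
  have [->|x2] := eqVneq x 2; last first.
    by exists 2; rewrite [2 == x]eq_sym x2 !gt_eqF //; lra.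
  by exists (-1); rewrite !lt_eqF //; lra.
have tt : idempotent (t *: c 0 + (1 - t) *: c 1).
  rewrite (idempotent_coord ef ee ff pq) pE qE.
  by apply/andP; split; apply/eqP; field.
have [i tE] : exists i, t *: c 0 + (1 - t) *: c 1 = c i.
  apply/(cP.2 _).1; rewrite tt; apply: contra_neq t0.
  by move/(free2P _ _ ef)=> [].
have coord (a b : R) : c i = a *: c 0 + b *: c 1 -> t = a.
  by rewrite -tE => /eqP; rewrite free2_inj // => /andP[/eqP].
case: (I3P i) => iE; move: coord; rewrite iE.
- move/(_ 1 0); rewrite scale1r scale0r addr0 => /(_ erefl) tE1.
  by rewrite tE1 eqxx in t1.
- move/(_ 0 1); rewrite scale1r scale0r add0r => /(_ erefl) tE0.
  by rewrite tE0 eqxx in t0.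
- by move/(_ _ _ gE) => tEx; rewrite tEx eqxx in tx.
Qed.

(** The a_i = 1 / (1 - 2 l_i) sum to 1, being the barycentric coordinates of 0
    with respect to the three idempotents. *)
Lemma inverse_eigenvalues_sum1 : exists l : 'I_3 -> R,
  [/\ forall i, endo_char_poly (mulop (c i)) = ('X - 1%:P) * ('X - (l i)%:P),
      forall i, 1 - 2 * l i != 0
    & \sum_i 1 / (1 - 2 * l i) = 1].
Proof.
have ef : free [:: c 0; c 1] by exact: nonzero_idempotents_free.
have fe : free [:: c 1; c 0] by exact: nonzero_idempotents_free.
have [ee ff] := (nonzero_idempotent 0, nonzero_idempotent 1).
have [p [q pq]] := free2_coord dimA (amul (c 0) (c 1)) ef.
have [x [y gE]] := free2_coord dimA (c 2) ef.
have y0 : y != 0.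
  apply/eqP=> y0; have /free2P : free [:: c 0; c 2].
    exact: nonzero_idempotents_free.
  case/(_ x (-1)); last by move=> _ /eqP; rewrite oppr_eq0 oner_eq0.
  by rewrite gE y0 scale0r addr0 scaleN1r subrr.
have x0 : x != 0.
  apply/eqP=> x0; have /free2P : free [:: c 1; c 2].
    exact: nonzero_idempotents_free.
  case/(_ y (-1)); last by move=> _ /eqP; rewrite oppr_eq0 oner_eq0.
  by rewrite gE x0 scale0r add0r scaleN1r subrr.
have xy1 := nonzero_idempotents_noncollinear gE x0 y0.
have := nonzero_idempotent 2; rewrite gE (idempotent_coord ef ee ff pq).
case/andP=> /eqP xE /eqP yE.
have {}xE : x + 2 * p * y = 1 by apply: (mulfI x0); rewrite mulr1.
have {}yE : y + 2 * q * x = 1 by apply: (mulfI y0); rewrite mulr1.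
have s0 : x + y - 1 != 0 by rewrite subr_eq0.
have pE : p = (1 - x) / (2 * y).
  by rewrite (_ : 1 - x = 2 * p * y); [field | lra].
have qE : q = (1 - y) / (2 * x).
  by rewrite (_ : 1 - y = 2 * q * x); [field | lra].
pose l (i : 'I_3) := if i == 0 then q else if i == 1 then p else (x + y) / 2.
(* The relation x c_0 + y c_1 - c_2 = 0 has coefficients proportional to the
   inverses of these three values. *)
have l0E : 1 - 2 * l 0 = (x + y - 1) / x by rewrite /l /= qE; field.
have l1E : 1 - 2 * l 1 = (x + y - 1) / y by rewrite /l /= pE; field.
have l2E : 1 - 2 * l 2 = - (x + y - 1) by rewrite /l /=; field.
exists l; split.
- move=> i; case: (I3P i) => ->; rewrite /l /=.
  + exact: (mulop_char_poly dimA ef ee pq).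
  + apply: (mulop_char_poly dimA fe ff); rewrite amulC pq addrC; reflexivity.
  + have gg := nonzero_idempotent 2; rewrite gE in gg *.
    rewrite (mulop_char_poly_comb dimA ef ee gg y0 pq).
    by congr (_ * ('X - _%:P)); rewrite pE qE; field; rewrite x0 y0.
- move=> i; case: (I3P i) => ->; rewrite ?l0E ?l1E ?l2E ?oppr_eq0 //.
  + by rewrite mulf_neq0 ?invr_neq0.
  + by rewrite mulf_neq0 ?invr_neq0.
- rewrite sumI3 l0E l1E l2E; field.
  by rewrite s0 x0 y0.
Qed.

End ThreeIdempotents.

(** * Idempotents of the algebras with product e f = k (e + f) *)

Definition sym_idempotents (K : fieldType) (A : commAlgebraType K)
    (k : K) (e f : A) : seq A :=
  [:: 0; e; f; (1 + 2 * k)^-1 *: (e + f)].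

(** In coordinates an idempotent x e + y f solves x (x + 2 k y) = x and
    y (y + 2 k x) = y.  If neither x nor y vanishes, the difference of
    x + 2 k y = 1 and y + 2 k x = 1 gives (1 - 2 k) (x - y) = 0, whence
    x = y = 1 / (1 + 2 k). *)
Lemma sym_idempotents_all (K : fieldType) (A : commAlgebraType K)
    (k : K) (e f : A) :
  \dim {:A} = 2%N -> free [:: e; f] -> idempotent e -> idempotent f ->
  amul e f = k *: (e + f) -> 1 - 2 * k != 0 -> 1 + 2 * k != 0 ->
  uniq (sym_idempotents k e f) /\
  forall v, (v \in sym_idempotents k e f) = idempotent v.
Proof.
rewrite /sym_idempotents => dimA ef_free ee ff ef km kp.
have {}ef : amul e f = k *: e + k *: f by rewrite ef scalerDr.
set s := (1 + 2 * k)^-1; have s0 : s != 0 by rewrite invr_eq0.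
have -> : [:: 0; e; f; s *: (e + f)] =
    [seq z.1 *: e + z.2 *: f | z <- [:: (0, 0); (1, 0); (0, 1); (s, s)]].
  by rewrite /= !scale0r !scale1r !addr0 add0r scalerDr.
split.
  rewrite map_inj_uniq; last first.
    move=> [a b] [a' b'] /eqP /=.
    by rewrite free2_inj // => /andP[/eqP-> /eqP->].
  rewrite /= !inE !xpair_eqE !eqxx !oner_eq0 ![0 == _]eq_sym.
  by rewrite (negPf s0) oner_eq0 /= !andbF.
have eqM (a b : K) : a != 0 -> (a * b == a) = (b == 1).
  by move=> a0; rewrite -[in RHS](inj_eq (mulfI a0)) mulr1.
move=> v; have [x [y ->]] := free2_coord dimA v ef_free.
rewrite (idempotent_coord ef_free ee ff ef) /= !inE !free2_inj //.
have [->|x0] /= := eqVneq x 0.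
  rewrite mul0r eqxx mulr0 addr0 ![0 == _]eq_sym oner_eq0 (negPf s0) /= !orbF.
  by have [->|/eqM->] := eqVneq y 0; rewrite ?mul0r ?eqxx.
have [->|y0] /= := eqVneq y 0.
  rewrite mul0r eqxx mulr0 addr0 [0 == s]eq_sym (negPf s0) andbF orbF !andbT.
  by rewrite eqM.
rewrite !andbF /= !eqM //.
apply/andP/andP=> [[/eqP-> /eqP->]|[/eqP xE /eqP yE]].
  by split; apply/eqP; rewrite /s; field.
have xy : x = y.
  apply: (mulfI km); apply/eqP; rewrite -subr_eq0; apply/eqP.
  transitivity ((x + 2 * k * y) - (y + 2 * k * x)); first by ring.
  by rewrite xE yE subrr.
rewrite -xy; suff -> : x = s by [].
apply: (mulfI kp); rewrite mulfV // -[RHS]xE -xy; ring.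
Qed.

Section Complexify.
Variables (R : rcfType) (A : commAlgebraType R).

Lemma complexifyD : {morph @complexify R A : x y / x + y}.
Proof. by move=> x y; congr (_, _); rewrite /= addr0. Qed.

Lemma complexifyZ (a : R) (x : A) :
  complexify (a *: x) = a%:C *: complexify x.
Proof.
by rewrite [RHS]/GRing.scale /= /cscale /= !scaler0 scale0r subr0 addr0.
Qed.

Lemma complexify_idempotent (x : A) : idempotent x -> idempotent (complexify x).
Proof. by move=> /eqP xx; rewrite /Defs.idempotent complexifyM xx. Qed.

Lemma complexify_free (e f : A) :
  free [:: e; f] -> free [:: complexify e; complexify f].
Proof.
move=> /free2P ef; apply/free2P => -[a a'] [b b'].
rewrite /GRing.scale /= /cscale /= !scaler0 !subr0 !add0r => -[/ef[-> ->]].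
by case/ef=> -> ->.
Qed.

Lemma complexify_sym_idempotents (k : R) (e f : A) :
  sym_idempotents k%:C (complexify e) (complexify f) =
  [seq complexify x | x <- sym_idempotents k e f].
Proof.
rewrite /sym_idempotents /= complexifyZ complexifyD; do 4 congr (_ :: _).
by congr (_ *: _); rewrite fmorphV rmorphD rmorphM rmorph1 rmorph_nat.
Qed.

End Complexify.

Section SymmetricProduct.
Variables (R : rcfType) (A : commAlgebraType R) (k : R) (e f : A).
Hypotheses (dimA : \dim {:A} = 2%N) (ef_free : free [:: e; f]).
Hypotheses (ee : idempotent e) (ff : idempotent f).
Hypothesis ef : amul e f = k *: (e + f).
Hypotheses (km : 1 - 2 * k != 0) (kp : 1 + 2 * k != 0).

Definition sym_triple (i : 'I_3) : A := (behead (sym_idempotents k e f))`_i.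

(** Over the complex numbers the list of idempotents is again the symmetric one
    for k, e and f, hence it is the complexification of the real list. *)
Lemma sym_real_generic : real_generic A.
Proof.
have [] := @sym_idempotents_all _ _ k%:C (complexify e) (complexify f).
- by rewrite dim_complexification.
- exact: complexify_free.
- exact: complexify_idempotent.
- exact: complexify_idempotent.
- by rewrite complexifyM ef complexifyZ complexifyD.
- have -> : 1 - 2 * k%:C = (1 - 2 * k)%:C.
    by rewrite rmorphB rmorphM rmorph1 rmorph_nat.
  by rewrite fmorph_eq0.
- have -> : 1 + 2 * k%:C = (1 + 2 * k)%:C.
    by rewrite rmorphD rmorphM rmorph1 rmorph_nat.
  by rewrite fmorph_eq0.
set s := sym_idempotents _ _ _ => s_uniq s_idem.
have sz : size s == (2 ^ \dim {:A})%N by rewrite dimA.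
split; first by exists (Tuple sz).
move=> u; rewrite -s_idem /s complexify_sym_idempotents => /mapP[x _ ->].
by exists x.
Qed.

Lemma sym_tripleP : nonzero_idempotents sym_triple.
Proof.
have [s_uniq s_idem] := sym_idempotents_all dimA ef_free ee ff ef km kp.
have /andP[s0 t_uniq] := s_uniq.
split=> [i j|x].
  move/eqP; rewrite /sym_triple nth_uniq // => /eqP; exact: val_inj.
rewrite -s_idem in_cons; split.
  case/andP=> /orP[->//|xt] _; have := xt; rewrite -index_mem => it.
  by exists (Ordinal it); rewrite /sym_triple nth_index.
case=> i ->; have it : sym_triple i \in behead (sym_idempotents k e f).
  exact: mem_nth.
by rewrite it orbT /=; apply: contraNneq s0 => <-.
Qed.

Lemma sym_triple_eigenvalues (i : 'I_3) :
  eigenvalues (mulop (sym_triple i))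
    [:: 1; ([:: k; k; (1 + 2 * k)^-1]`_i)%:C].
Proof.
have efE : amul e f = k *: e + k *: f by rewrite ef scalerDr.
have fe_free : free [:: f; e] by rewrite -(perm_free (permEl (perm_rot 1 _))).
have [_ s_idem] := sym_idempotents_all dimA ef_free ee ff ef km kp.
have gg : idempotent (sym_triple 2) by rewrite -s_idem !inE eqxx !orbT.
apply/eigenvaluesE; last reflexivity.
case: (I3P i) => -> /=.
- exact: mulop_char_poly efE.
- by apply: (mulop_char_poly dimA fe_free ff (p := k)); rewrite amulC efE addrC.
- move: gg; rewrite /sym_triple /= scalerDr => gg.
  rewrite (mulop_char_poly_comb dimA ef_free ee gg _ efE) ?invr_eq0 //.
  by rewrite addrK.
Qed.

End SymmetricProduct.

(** * A model of the product e f = k (e + f) *)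

Section SymmetricPlane.
Variable (K : fieldType).

Definition sym_plane (k : K) : Type := (K^o * K^o)%type.

Variable k : K.
HB.instance Definition _ := Vector.copy (sym_plane k) (K^o * K^o)%type.

Definition sym_plane_mul (u v : sym_plane k) : sym_plane k :=
  (u.1 * v.1 + k * (u.1 * v.2 + u.2 * v.1),
   u.2 * v.2 + k * (u.1 * v.2 + u.2 * v.1)).

Fact sym_plane_mulC : commutative sym_plane_mul.
Proof. by move=> u v; rewrite /sym_plane_mul; congr (_, _); ring. Qed.

Fact sym_plane_mulDl : left_distributive sym_plane_mul +%R.
Proof. by move=> u v w; rewrite /sym_plane_mul; congr (_, _) => /=; ring. Qed.

Fact sym_plane_mulZl (a : K) (u v : sym_plane k) :
  sym_plane_mul (a *: u) v = a *: sym_plane_mul u v.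
Proof.
rewrite /sym_plane_mul; congr (_, _) => /=; rewrite /GRing.scale /=; ring.
Qed.

HB.instance Definition _ := Vector_isCommNAAlgebra.Build K (sym_plane k)
  sym_plane_mulC sym_plane_mulDl sym_plane_mulZl.

Lemma dim_sym_plane : \dim {: sym_plane k} = 2%N.
Proof. by rewrite dimvf /dim /=. Qed.

Definition sym_plane_e : sym_plane k := (1, 0).
Definition sym_plane_f : sym_plane k := (0, 1).

Lemma sym_plane_free : free [:: sym_plane_e; sym_plane_f].
Proof.
apply/free2P => a b [].
by rewrite /GRing.scale /= !mulr0 !mulr1 addr0 add0r.
Qed.

Lemma sym_plane_e_idempotent : idempotent sym_plane_e.
Proof. by apply/eqP; congr (_, _) => /=; ring. Qed.

Lemma sym_plane_f_idempotent : idempotent sym_plane_f.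
Proof. by apply/eqP; congr (_, _) => /=; ring. Qed.

Lemma sym_plane_ef :
  amul sym_plane_e sym_plane_f = k *: (sym_plane_e + sym_plane_f).
Proof. by congr (_, _) => /=; rewrite /GRing.scale /=; ring. Qed.

End SymmetricPlane.

(** Here a_1 = a_2 = 1 / (1 - 2 k) and a_3 = - (1 + 2 k) / (1 - 2 k), so that the
    two signs in the third hypothesis decide the configuration. *)
Lemma sym_plane_realizes (R : rcfType) (k : R) (signs : seq R) :
  1 - 2 * k != 0 -> 1 + 2 * k != 0 ->
  perm_eq [:: Num.sg (1 - 2 * k); Num.sg (1 - 2 * k);
             - (Num.sg (1 + 2 * k) * Num.sg (1 - 2 * k))] signs ->
  exists (A : commAlgebraType R) (c : 'I_3 -> A) (l : 'I_3 -> R),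
    [/\ real_generic A, \dim {:A} = 2%N, nonzero_idempotents c,
        forall i, eigenvalues (mulop (c i)) [:: 1; (l i)%:C]
      & sign_configuration (fun i => 1 / (1 - 2 * l i)) signs].
Proof.
move=> km kp signsE.
have [ee ff] := (sym_plane_e_idempotent k, sym_plane_f_idempotent k).
have [ef_free ef] := (sym_plane_free k, sym_plane_ef k).
have dimA := dim_sym_plane k.
exists (sym_plane k), (sym_triple k (sym_plane_e k) (sym_plane_f k)).
exists (fun i => [:: k; k; (1 + 2 * k)^-1]`_i); split=> //.
- exact: sym_real_generic ef km kp.
- exact: sym_tripleP ef km kp.
- exact: sym_triple_eigenvalues ef km kp.
rewrite sign_configurationE /= !div1r.
have -> : (1 - 2 / (1 + 2 * k))^-1 = - ((1 + 2 * k) / (1 - 2 * k)).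
  field; rewrite km kp -oppr_eq0 (_ : - _ = 1 - 2 * k) ?km //; ring.
by rewrite sgrN sgrM !sgrV.
Qed.

Unset Implicit Arguments.
Set Strict Implicit.

Theorem mainTheorem1 (R : realType) :
  (forall A : commAlgebraType R,
     real_generic A -> \dim {:A} = 2%N ->
     forall c : 'I_3 -> A, nonzero_idempotents c ->
     (exists lambda : 'I_3 -> R[i],
        forall i, eigenvalues (mulop (c i)) [:: 1; lambda i]) /\
     (forall lambda : 'I_3 -> R[i],
        (forall i, eigenvalues (mulop (c i)) [:: 1; lambda i]) ->
        exists l : 'I_3 -> R,
          [/\ forall i, lambda i = (l i)%:C,
              forall i, l i != 2^-1
            & let a := fun i => 1 / (1 - 2 * l i) in
              [\/ sign_configuration a [:: 1; 1; 1],
                  sign_configuration a [:: 1; 1; -1]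
                | sign_configuration a [:: 1; -1; -1]]])) /\
  (forall signs : seq R,
     signs \in [:: [:: 1; 1; 1]; [:: 1; 1; -1]; [:: 1; -1; -1]] ->
     exists (A : commAlgebraType R) (c : 'I_3 -> A) (l : 'I_3 -> R),
       [/\ real_generic A, \dim {:A} = 2%N, nonzero_idempotents c,
           forall i, eigenvalues (mulop (c i)) [:: 1; (l i)%:C]
         & sign_configuration (fun i => 1 / (1 - 2 * l i)) signs]).
Proof.
split.
  move=> A _ dimA c cP.
  have [l [lE l_neq l_sum]] := inverse_eigenvalues_sum1 dimA cP.
  split.
    by exists (fun i => (l i)%:C) => i; apply/(eigenvaluesE (lE i)).
  move=> lambda lambdaE; exists l; split.
  - by move=> i; apply/(eigenvaluesE (lE i)).
  - move=> i; apply: contraNneq (l_neq i) => ->.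
    by rewrite divff ?subrr // pnatr_eq0.
  - apply: sign_configurations; last by rewrite l_sum.
    by move=> i; rewrite div1r invr_eq0.
move=> signs; rewrite !inE => /or3P[] /eqP->.
- have km : 0 < 1 - 2 * (-1) :> R by lra.
  have kp : 1 + 2 * (-1) < 0 :> R by lra.
  apply: (sym_plane_realizes (lt0r_neq0 km) (ltr0_neq0 kp)).
  by rewrite (gtr0_sg km) (ltr0_sg kp) mulr1 opprK.
- have km : 0 < 1 - 2 * 0 :> R by lra.
  have kp : 0 < 1 + 2 * 0 :> R by lra.
  apply: (sym_plane_realizes (lt0r_neq0 km) (lt0r_neq0 kp)).
  by rewrite (gtr0_sg km) (gtr0_sg kp) mulr1.
- have km : 1 - 2 * 1 < 0 :> R by lra.
  have kp : 0 < 1 + 2 * 1 :> R by lra.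
  apply: (sym_plane_realizes (ltr0_neq0 km) (lt0r_neq0 kp)).
  by rewrite (ltr0_sg km) (gtr0_sg kp) mul1r opprK -(perm_rot 2).
Qed.
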